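(* We have $$f_{0001}(x)=\frac{1-5x+8x^2-10x^4+5x^5+x^6+x^8}{(1-x)^3(1-x-x^2)^3}$$ as formal power series in $x$, where $f_{0001}(x)=\sum_{n\ge 0} b_n(0001)x^n$ and $b_n(0001)$ is the number of ascent sequences of length $n$ that avoid both patterns $021$ and $0001$.
   Context: For a finite sequence $w=w_1\cdots w_n$ of integers, $\mathrm{asc}(w)$ is the number of indices $1\le i\le n-1$ with $w_i<w_{i+1}$. An ascent sequence of length $n\ge 1$ is a sequence $a_1\cdots a_n$ of non-negative integers such that $a_1=0$ and $a_i\le \mathrm{asc}(a_1\cdots a_{i-1})+1$ for $1<i\le n$; there is exactly one (empty) ascent sequence of length $0$. A sequence $\pi=\pi_1\cdots\pi_n$ contains a pattern $\tau=\tau_1\cdots\tau_m$ if there are indices $1\le i_1<\cdots<i_m\le n$ such that for all $j,k\in\{1,\dots,m\}$: $\pi_{i_j}<\pi_{i_k}$ iff $\tau_j<\tau_k$, and $\pi_{i_j}=\pi_{i_k}$ iff $\tau_j=\tau_k$; otherwise $\pi$ avoids $\tau$. For a pattern $\tau$, $B_n(\tau)$ is the set of ascent sequences of length $n$ avoiding both $021$ and $\tau$ (with $B_0(\tau)$ consisting of the empty sequence), and $b_n(\tau)=|B_n(\tau)|$. *)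

(* Defs.v *)
From mathcomp Require Import all_boot all_order all_algebra.

Set Implicit Arguments.
Unset Strict Implicit.
Unset Printing Implicit Defensive.

Import GRing.Theory.

Definition asc (w : seq nat) : nat :=
  #|[set i : 'I_(size w).-1 | nth 0 w i < nth 0 w i.+1]|.

(* Positions are 0-based, so [take i w] is the prefix of [w] strictly before the
   entry at position [i]; the empty sequence satisfies the predicate. *)
Definition is_ascent_seq (w : seq nat) : bool :=
  (head 0 w == 0) &&
  [forall i : 'I_(size w), (0 < i) ==> (nth 0 w i <= asc (take i w) + 1)].

Definition contains (w tau : seq nat) : bool :=
  [exists f : {ffun 'I_(size tau) -> 'I_(size w)},
    [forall j : 'I_(size tau), forall k : 'I_(size tau), (j < k) ==> (f j < f k)] &&
    [forall j : 'I_(size tau), forall k : 'I_(size tau),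
      ((nth 0 w (f j) < nth 0 w (f k)) == (nth 0 tau j < nth 0 tau k)) &&
      ((nth 0 w (f j) == nth 0 w (f k)) == (nth 0 tau j == nth 0 tau k))]].

Definition avoids (w tau : seq nat) : bool := ~~ contains w tau.

Definition word (n : nat) (t : n.-tuple 'I_n) : seq nat := [seq val i | i <- t].

(* The entries of an ascent sequence of length n are smaller than n
   (see [ascent_seq_word]), so taking letters in 'I_n loses nothing. *)
Definition B_ (tau : seq nat) (n : nat) : {set n.-tuple 'I_n} :=
  [set t | [&& is_ascent_seq (word t),
               avoids (word t) [:: 0; 2; 1] & avoids (word t) tau]].

Definition b_ (tau : seq nat) (n : nat) : nat := #|B_ tau n|.

Lemma word_inj n : injective (@word n).
Proof. by move=> s t /(inj_map val_inj) /val_inj. Qed.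

Lemma asc_le w : asc w <= (size w).-1.
Proof. by rewrite -[leqRHS]card_ord; apply: max_card. Qed.

Lemma ascent_seq_word w :
  is_ascent_seq w -> exists t : (size w).-tuple 'I_(size w), word t = w.
Proof.
case/andP=> /eqP w0 /forallP Hw.
have lt_w (i : 'I_(size w)) : nth 0 w i < size w.
  case: (posnP i) => [i0|i_gt0].
    by rewrite i0 nth0 w0 -i0.
  apply: leq_ltn_trans (ltn_ord i).
  apply: leq_trans (implyP (Hw i) i_gt0) _.
  rewrite addn1; apply: leq_ltn_trans (asc_le _) _.
  by rewrite size_take ltn_ord prednK.
exists [tuple Ordinal (lt_w i) | i < size w].
apply: (@eq_from_nth _ 0); first by rewrite size_map size_tuple.
move=> i; rewrite size_map size_tuple => lti.
rewrite /word (nth_map (Ordinal lti)) ?size_tuple //.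
by rewrite -[i]/(nat_of_ord (Ordinal lti)) -tnth_nth tnth_mktuple.
Qed.

Local Open Scope ring_scope.

(* A formal power series is its sequence of coefficients. *)
Definition fps (F : fieldType) : Type := nat -> F.

Definition fps_of_poly (F : fieldType) (p : {poly F}) : fps F := fun n => p`_n.

Definition fps_mul (F : fieldType) (g h : fps F) : fps F :=
  fun n => \sum_(i < n.+1) g i * h (n - i)%N.

(* [fps_inv_coefs g n] lists the coefficients 0, ..., n of 1 / g, obtained by
   solving g * (1 / g) = 1 coefficient by coefficient; meaningful for g 0 != 0
   (see [fps_mulV]). *)
Fixpoint fps_inv_coefs (F : fieldType) (g : fps F) (n : nat) : seq F :=
  if n is m.+1 then
    let s := fps_inv_coefs g m in
    rcons s (- (g 0%N)^-1 * \sum_(i < m.+1) g i.+1 * s`_(m - i))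
  else [:: (g 0%N)^-1].

Definition fps_inv (F : fieldType) (g : fps F) : fps F :=
  fun n => (fps_inv_coefs g n)`_n.

Definition fps_div (F : fieldType) (g h : fps F) : fps F :=
  fps_mul g (fps_inv h).

Lemma size_fps_inv_coefs (F : fieldType) (g : fps F) n :
  size (fps_inv_coefs g n) = n.+1.
Proof. by elim: n => //= n IHn; rewrite size_rcons IHn. Qed.

Lemma nth_fps_inv_coefs (F : fieldType) (g : fps F) n i :
  (i <= n)%N -> (fps_inv_coefs g n)`_i = fps_inv g i.
Proof.
elim: n => [|n IHn]; first by rewrite leqn0 => /eqP->.
rewrite leq_eqVlt => /predU1P[-> //|lt_in].
by rewrite /= nth_rcons size_fps_inv_coefs lt_in IHn.
Qed.

Lemma fps_mulV (F : fieldType) (g : fps F) :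
  g 0%N != 0 -> fps_mul g (fps_inv g) =1 fps_of_poly 1.
Proof.
move=> g0 [|n]; rewrite /fps_mul /fps_of_poly coef1.
  by rewrite big_ord1 /fps_inv /= divff.
rewrite big_ord_recl subn0 {1}/fps_inv /= nth_rcons size_fps_inv_coefs.
rewrite ltnn eqxx mulrA mulrN divff // mulN1r.
apply/eqP; rewrite addrC subr_eq0; apply/eqP/eq_bigr => i _.
by rewrite subSS nth_fps_inv_coefs // leq_subr.
Qed.

Definition f_ (tau : seq nat) : fps rat := fun n => (b_ tau n)%:R.

(* Main.v *)
(** An ascent sequence avoids 021 iff its nonzero entries weakly increase, and then
    0001 is avoided iff every letter exceeding [x] comes before the third [x].
    So the possible continuations of a prefix depend only on its number of zeros,
    whether it ends with 0, the slack [asc - max], and the multiplicity of its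
    maximum.  The slack only takes the values 0 and 1 and the counts saturate at 3,
    so the numbers of continuations satisfy a finite linear system; eliminating
    the auxiliary states gives the recurrence encoded by the denominator. *)

Require Import Defs.
From mathcomp Require Import all_boot all_order all_algebra.
From mathcomp Require Import zify ring lra.

Import GRing.Theory.

(** * Pattern containment as a subsequence relation *)

Definition order_iso (s tau : seq nat) : Prop :=
  size s = size tau /\
  forall j k, j < size tau -> k < size tau ->
    (nth 0 s j < nth 0 s k) = (nth 0 tau j < nth 0 tau k) /\
    (nth 0 s j == nth 0 s k) = (nth 0 tau j == nth 0 tau k).

Lemma sorted_ltn_iota_subseq (l : seq nat) n :
  sorted ltn l -> all (ltn^~ n) l -> subseq l (iota 0 n).
Proof.
move=> sl ln.
rewrite (_ : l = filter (mem l) (iota 0 n)) ?filter_subseq //.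
apply: (irr_sorted_eq ltn_trans ltnn sl).
  by apply: (sorted_filter ltn_trans); apply: iota_ltn_sorted.
move=> i; rewrite mem_filter mem_iota add0n /=.
by case: (boolP (i \in l)) => //= /(allP ln).
Qed.

(** Subsequences replace index embeddings, which makes the effect of appending one letter
    tractable. *)
Lemma containsP (w tau : seq nat) :
  reflect (exists2 s, subseq s w & order_iso s tau) (contains w tau).
Proof.
apply: (iffP existsP) => [[f /andP[/forallP incf /forallP isof]]|].
  have inc (j k : 'I_(size tau)) : j < k -> f j < f k.
    by move=> ltjk; have /forallP/(_ k)/implyP := incf j; apply.
  pose l := [seq val (f j) | j <- enum 'I_(size tau)].
  have szl : size l = size tau by rewrite size_map size_enum_ord.
  have nl (j : 'I_(size tau)) : nth 0 l j = f j.
    by rewrite (nth_map j) ?size_enum_ord // nth_ord_enum.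
  exists [seq nth 0 w i | i <- l].
    rewrite -[X in subseq _ X](mkseq_nth 0); apply: map_subseq.
    apply: sorted_ltn_iota_subseq.
      rewrite sorted_map; apply: sub_sorted (_ : sorted (relpre val ltn) _).
        by move=> x y /inc.
      by rewrite -sorted_map val_enum_ord iota_ltn_sorted.
    by apply/allP => _ /mapP[j _ ->] /=.
  split; first by rewrite size_map.
  move=> j k ltj ltk; rewrite !(nth_map 0) ?szl //.
  rewrite -[j]/(val (Ordinal ltj)) -[k]/(val (Ordinal ltk)) !nl.
  by have /forallP/(_ (Ordinal ltk))/andP[/eqP-> /eqP->] := isof (Ordinal ltj).
case=> s /subseqP[m szm ->] [szs iso_s].
pose l := mask m (iota 0 (size w)).
have defs : mask m w = [seq nth 0 w i | i <- l].
  by rewrite /l map_mask -/(mkseq _ _) mkseq_nth.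
rewrite defs size_map in szs.
have sl : sorted ltn l.
  by apply: (sorted_mask ltn_trans); apply: iota_ltn_sorted.
have ltl (j : 'I_(size tau)) : nth 0 l j < size w.
  have /mem_mask : nth 0 l j \in l by rewrite mem_nth // szs.
  by rewrite mem_iota.
exists [ffun j => Ordinal (ltl j)]; apply/andP; split.
  apply/forallP=> j; apply/forallP=> k; apply/implyP=> ltjk; rewrite !ffunE /=.
  by apply: (sorted_ltn_nth ltn_trans) => //; rewrite inE szs.
apply/forallP=> j; apply/forallP=> k; rewrite !ffunE /=.
have := iso_s j k (ltn_ord j) (ltn_ord k).
by rewrite defs !(nth_map 0) ?szs // => -[-> ->]; rewrite !eqxx.
Qed.

Lemma subseq_rcons2 (s w : seq nat) x a :
  subseq (rcons s x) (rcons w a) = subseq (if x == a then s else rcons s x) w.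
Proof.
rewrite -subseq_rev !rev_rcons /=; case: eqP => _; first by rewrite subseq_rev.
by rewrite -rev_rcons subseq_rev.
Qed.

Lemma contains_rconsl w a tau : contains w tau -> contains (rcons w a) tau.
Proof.
by case/containsP=> s sw iso; apply/containsP; exists s => //;
  apply: subseq_trans sw (subseq_rcons _ _).
Qed.

Lemma contains_rcons w a s x :
  contains (rcons w a) (rcons s x) ->
  contains w (rcons s x) \/
  exists2 t, subseq t w & order_iso (rcons t a) (rcons s x).
Proof.
case/containsP=> t; case: (lastP t) => [|t' y] sw iso.
  by case: iso => /eqP; rewrite size_rcons.
move: sw; rewrite subseq_rcons2; case: eqP => [eq_ya|_] sw.
  by right; exists t' => //; rewrite -eq_ya.
by left; apply/containsP; exists (rcons t' y).
Qed.

(** * Occurrences of 021 and 0001 created by a new last letter *)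

Definition maxw (w : seq nat) := \max_(i <- w) i.

Lemma maxw_rcons w a : maxw (rcons w a) = maxn (maxw w) a.
Proof. by rewrite /maxw -cats1 big_cat big_seq1. Qed.

Lemma leq_maxw w i : i \in w -> i <= maxw w.
Proof. by move=> iw; rewrite /maxw (big_rem i) //= leq_maxl. Qed.

Lemma maxw_mem w : 0 < maxw w -> maxw w \in w.
Proof.
elim/last_ind: w => [|w a IH]; first by rewrite /maxw big_nil.
rewrite maxw_rcons mem_rcons inE.
case: (leqP (maxw w) a) => [_|_ /IH->]; last by rewrite orbT.
by rewrite eqxx.
Qed.

(** The leading 0 can always play the 0 of the pattern and the maximum is the best candidate for the
    2, so it suffices to compare [a] with these two letters. *)
Lemma contains021_rcons w a : head 0 w = 0 ->
  contains (rcons w a) [:: 0; 2; 1]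
    = contains w [:: 0; 2; 1] || (0 < a < maxw w).
Proof.
move=> w0; apply/idP/orP => [|[|/andP[a0 am]]]; [|exact: contains_rconsl|].
  case/(contains_rcons w a [:: 0; 2] 1) => [|[t tw [szt iso]]]; first by left.
  right; move/eqP: szt tw iso; rewrite !size_rcons eqSS.
  case: t => [|x [|y [|? ?]]] //= _ tw iso.
  have [+ _] := iso 0 2 isT isT; have [+ _] := iso 2 1 isT isT => /= ay xa.
  rewrite (leq_ltn_trans _ xa) //=; apply: leq_trans ay _.
  by apply: leq_maxw; apply: mem_subseq tw _ _; rewrite !inE eqxx orbT.
apply/containsP; exists [:: 0; maxw w; a].
  rewrite (subseq_rcons2 [:: 0; maxw w]) eqxx.
  have := maxw_mem w (ltn_trans a0 am).
  case: w w0 am => [|x w] //= -> am; rewrite inE sub1seq.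
  by case/orP => [/eqP m0|//]; rewrite m0 in am.
have m0 := ltn_trans a0 am.
split=> // -[|[|[|//]]] [|[|[|//]]] _ _ /=;
  by rewrite ?ltnn ?eqxx ?am ?a0 ?m0 // ?[_ < 0]ltn0 ?ltnNge ?(ltnW am) //;
  rewrite ?(gtn_eqF am) ?(ltn_eqF am) ?(ltn_eqF a0) ?(gtn_eqF a0)
          ?(ltn_eqF m0) ?(gtn_eqF m0).
Qed.

Lemma subseq_nseq (w : seq nat) n x : subseq (nseq n x) w = (n <= count_mem x w).
Proof.
apply/idP/idP => [H|le_n].
  by have := leq_count_subseq (pred1 x) H; rewrite count_nseq /= eqxx mul1n.
apply: subseq_trans (filter_subseq (pred1 x) w).
have /all_pred1P -> := filter_all (pred1 x) w.
by rewrite size_filter -(subnKC le_n) nseqD prefix_subseq.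
Qed.

Lemma contains0001_rcons w a :
  contains (rcons w a) [:: 0; 0; 0; 1]
    = contains w [:: 0; 0; 0; 1] || has (fun x => (x < a) && (2 < count_mem x w)) w.
Proof.
apply/idP/orP => [|[|/hasP[x xw /andP[xa cx]]]]; [|exact: contains_rconsl|].
  case/(contains_rcons w a [:: 0; 0; 0] 1) => [|[t tw [szt iso]]]; first by left.
  right; move/eqP: szt tw iso; rewrite !size_rcons eqSS.
  case: t => [|x [|y [|z [|? ?]]]] //= _ tw iso.
  have [xa _] := iso 0 3 isT isT.
  have [_ /eqP xy] := iso 0 1 isT isT; have [_ /eqP xz] := iso 0 2 isT isT.
  move: tw xa xy xz => /= tw xa xy xz; subst y z.
  apply/hasP; exists x; first by apply: mem_subseq tw _ _; rewrite inE eqxx.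
  by rewrite xa -subseq_nseq.
apply/containsP; exists [:: x; x; x; a].
  by rewrite (subseq_rcons2 [:: x; x; x]) eqxx (subseq_nseq w 3).
by split=> // -[|[|[|[|//]]]] [|[|[|[|//]]]] _ _ /=;
  rewrite ?ltnn ?eqxx ?xa ?(ltn_eqF xa) ?(gtn_eqF xa) // ltnNge ltnW.
Qed.

(** * Ascents under appending a letter *)

Lemma asc_sum w : asc w = \sum_(0 <= i < (size w).-1) (nth 0 w i < nth 0 w i.+1).
Proof.
rewrite /asc cardsE -sum1_card big_mkcond big_mkord.
by apply: eq_bigr.
Qed.

Lemma asc_rcons (w : seq nat) (a : nat) :
  w != [::] -> asc (rcons w a) = asc w + (last 0 w < a).
Proof.
move=> wn; have sw : 0 < size w by case: w wn.
rewrite !asc_sum size_rcons /= -{1}(prednK sw) big_nat_recr //= prednK //.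
congr (_ + _).
  apply: eq_big_nat => i /andP[_ lti]; rewrite !nth_rcons.
  by rewrite -ltn_predRL lti (leq_trans lti) ?leq_pred.
by rewrite !nth_rcons prednK // leqnn ltnn eqxx nth_last.
Qed.

Lemma is_ascent_seq_rcons (w : seq nat) (a : nat) : w != [::] ->
  is_ascent_seq (rcons w a) = is_ascent_seq w && (a <= asc w + 1).
Proof.
move=> wn; have sw : 0 < size w by case: w wn.
rewrite /is_ascent_seq -andbA; congr (_ && _); first by case: w wn sw.
apply/forallP/andP => [H|[/forallP H Ha] [i lti]] /=.
  split; last first.
    have lt : size w < size (rcons w a) by rewrite size_rcons.
    have := implyP (H (Ordinal lt)) sw.
    by rewrite /= nth_rcons ltnn eqxx -cats1 take_size_cat.
  apply/forallP => i; apply/implyP=> i0.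
  have lt : i < size (rcons w a) by rewrite size_rcons ltnS ltnW.
  have := implyP (H (Ordinal lt)) i0.
  by rewrite /= nth_rcons ltn_ord -cats1 takel_cat // ltnW.
apply/implyP=> i0; move: (lti); rewrite size_rcons ltnS leq_eqVlt nth_rcons.
case/predU1P => [->|ltiw].
  by rewrite ltnn eqxx -cats1 take_size_cat.
by rewrite ltiw -cats1 takel_cat ?(ltnW ltiw) //; exact: (implyP (H (Ordinal ltiw))).
Qed.

(** * Good words and their invariants *)

Definition good (w : seq nat) : bool :=
  [&& is_ascent_seq w, avoids w [:: 0; 2; 1] & avoids w [:: 0; 0; 0; 1]].

Lemma good_rcons (w : seq nat) (a : nat) : w != [::] ->
  good (rcons w a) =
  [&& good w, a <= asc w + 1, (a == 0) || (maxw w <= a)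
    & all (fun x => (x < a) ==> (count_mem x w <= 2)) w].
Proof.
move=> wn; rewrite /good is_ascent_seq_rcons // /avoids contains0001_rcons.
case: (boolP (is_ascent_seq w)) => //= /andP[/eqP w0 _].
rewrite contains021_rcons // !negb_or.
have -> : ~~ (0 < a < maxw w) = (a == 0) || (maxw w <= a) by lia.
rewrite -all_predC; set b := all _ w; set b' := all _ w.
have -> : b = b' by apply: eq_all => x /=; case: (x < a) => //=; rewrite -leqNgt.
by do 2! case: contains => //=; rewrite ?andbF ?andbT.
Qed.

(** Nonzero letters weakly increase, so the last letter is 0 or the maximum. A positive letter below
    the maximum cannot recur once a larger one has come, and 0001 caps its earlier occurrences at 2.
    Hence only the multiplicities of 0 and of the maximum matter for 0001. *)
Lemma good_inv (w : seq nat) : w != [::] -> good w ->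
  [/\ maxw w <= asc w, last 0 w = 0 \/ last 0 w = maxw w
    & forall x, 0 < x < maxw w -> count_mem x w <= 2].
Proof.
elim/last_ind: w => // w a IH _; case: (altP (w =P [::])) => [->|wn].
  case/and3P=> /andP[/eqP /= -> _] _ _; rewrite /maxw big_seq1.
  by split; [|left|case].
rewrite good_rcons // => /and4P[/(IH wn)[mx lst cnt] le_a a0m /allP ca].
rewrite maxw_rcons asc_rcons // last_rcons.
have lm : last 0 w <= maxw w by case: lst => ->.
split.
(* Without a new ascent, [a] is at most the last letter, hence at most the old maximum. *)
- by case: (ltnP (last 0 w) a) => /=; lia.
- by case/orP: a0m => [/eqP|]; lia.
move=> x; rewrite -cats1 count_cat /= => /andP[x0 xm].
case: (ltnP x (maxw w)) => xw.
  rewrite (_ : (a == x) = false) ?addn0 ?cnt ?x0 //.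
  by apply/eqP => ax; case/orP: a0m => [/eqP|]; lia.
case: (boolP (x \in w)) => [/ca|/count_memPn ->]; last by case: eqP.
by case: (ltnP x a) => /= xa; lia.
Qed.

(** * Counting continuations by state *)

(* Multiplicity of the largest letter, or 0 as long as only zeros occurred. *)
Definition cmax (w : seq nat) := if maxw w == 0 then 0 else count_mem (maxw w) w.

(* Number of ways to append [n] letters to a prefix with [z] zeros, slack
   [d = asc - max] and maximum of multiplicity [c]; [l] tells whether it ends
   with 0.  The three summands append 0, the maximum, and a larger letter. *)
Fixpoint extensions (n z : nat) (l : bool) (d c : nat) : nat :=
  if n is m.+1 then
    extensions m z.+1 true d c +
    (if z < 3 then
      (if 0 < c then extensions m z false (d + l) c.+1 else 0) +
      (if c < 3 then \sum_(j < d.+1) extensions m z false (d - j) 1 else 0)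
     else 0)
  else 1.

(** The alphabet size [K] stays fixed while the prefix grows, so recursion on [n] is possible; a [K]
    no smaller than the final length excludes no valid letter. *)
Definition num_ext (K n : nat) (w : seq nat) : nat :=
  \sum_(t : n.-tuple 'I_K) good (w ++ [seq val i | i <- t]).

Lemma num_ext0 K w : num_ext K 0 w = good w.
Proof.
rewrite /num_ext (big_pred1 [tuple]) ?cats0 // => t /=.
by apply/esym/eqP/tuple0.
Qed.

Lemma num_extS K n w : num_ext K n.+1 w = \sum_(a < K) num_ext K n (rcons w a).
Proof.
rewrite /num_ext pair_big /=.
rewrite (reindex (fun p : 'I_K * n.-tuple 'I_K => cons_tuple p.1 p.2)) /=.
  by apply: eq_bigr => -[a t] _; rewrite /= cat_rcons.
exists (fun t : n.+1.-tuple 'I_K => (thead t, behead_tuple t)) => [[a t] _|t _].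
  by congr (_, _); apply: val_inj.
by apply: val_inj; rewrite [t in RHS]tuple_eta.
Qed.

Lemma num_ext_bad K n (w : seq nat) : w != [::] -> ~~ good w -> num_ext K n w = 0.
Proof.
elim: n w => [|n IH] w wn bad; first by rewrite num_ext0 (negPf bad).
rewrite num_extS big1 // => a _; apply: IH; first by case: w {wn bad}.
by rewrite good_rcons // (negPf bad).
Qed.

(** The next letter is 0, at most the maximum, or above it. Appending a positive maximum creates an
    ascent exactly when the last letter is 0, which raises the slack; a larger letter always creates
    one and lowers the slack by its excess over [maxw w + 1]. *)
Lemma num_ext_extensions K n (w : seq nat) : w != [::] -> good w -> size w + n <= K ->
  num_ext K n w =
    extensions n (count_mem 0 w) (last 0 w == 0) (asc w - maxw w) (cmax w).
Proof.
elim: n w => [|n IH] w wn gw szK; first by rewrite num_ext0 gw.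
have sw : 0 < size w by case: w wn {gw szK}.
have [mx lst cnt] := good_inv w wn gw.
have aw := asc_le w.
have wn' a : rcons w a != [::] by case: w {wn gw szK sw mx lst cnt aw IH}.
have szK' a : size (rcons w a) + n <= K by rewrite size_rcons; lia.
have c0 x : x \notin w -> count_mem x w = 0 by move/count_memPn.
have rule a := good_rcons w a wn; rewrite gw /= in rule.
rewrite num_extS -(big_mkord xpredT (fun a => num_ext K n (rcons w a))).
rewrite big_ltn; last lia.
congr (_ + _).
  rewrite IH ?rule //=; last by apply/allP.
  rewrite last_rcons asc_rcons // ltn0 addn0 /cmax maxw_rcons maxn0.
  rewrite -cats1 !count_cat /= addn0 addn1.
  by congr (extensions _ _ _ _ _); case: eqP => //; case: (maxw w) => // ?; lia.
(* Positive letters below the maximum would complete a 021, so only the maximum contributes; if [w]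
   has only zeros, the range is empty and [cmax w] is 0. *)
have mcase : \sum_(1 <= a < (maxw w).+1) num_ext K n (rcons w a) =
   if (count_mem 0 w < 3) && (0 < cmax w) then
     extensions n (count_mem 0 w) false ((asc w - maxw w) + (last 0 w == 0)) (cmax w).+1
   else 0.
  case: (posnP (maxw w)) => [m0|m0].
    by rewrite m0 big_geq // /cmax m0 eqxx ltnn andbF.
  have cm : cmax w = count_mem (maxw w) w by rewrite /cmax eqn0Ngt m0.
  have cm0 : 0 < cmax w by rewrite cm -has_count has_pred1 maxw_mem.
  rewrite cm0 andbT big_nat_recr //= big_nat big1 => [|a /andP[a1 am]]; last first.
    by rewrite num_ext_bad // rule; apply/negP => /and3P[_ + _]; lia.
  rewrite add0n.
  (* Intermediate letters occur at most twice, so only three zeros can forbid the maximum. *)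
  have -> : (count_mem 0 w < 3) = good (rcons w (maxw w)).
    rewrite rule leqnn orbT (leq_trans mx) ?leq_addr //=.
    apply/idP/allP => [c3 x xw|/(_ 0)].
      apply/implyP=> xm; case: (posnP x) => [->//|x0].
      by apply: cnt; rewrite x0.
    rewrite m0 /= -ltnS => H; case: (boolP (0 \in w)) => [/H //|/c0 ->//].
  case: ifP => g; last by rewrite num_ext_bad ?g.
  rewrite IH // last_rcons asc_rcons // maxw_rcons maxnn /cmax maxw_rcons maxnn.
  rewrite -cats1 !count_cat /= eqxx addn0 addn1 !eqn0Ngt m0 /= addn0.
  congr (extensions _ _ _ _ _); rewrite -?eqn0Ngt.
  by case: lst => ->; rewrite ?m0 ?ltnn ?(gtn_eqF m0) /=; lia.
have hi : \sum_((maxw w).+1 <= a < K) num_ext K n (rcons w a) =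
   if (count_mem 0 w < 3) && (cmax w < 3) then
     \sum_(j < (asc w - maxw w).+1)
        extensions n (count_mem 0 w) false (asc w - maxw w - j) 1
   else 0.
  (* Letters above [asc w + 1] violate the ascent bound; as [asc w < size w], the cut lies within
     the alphabet. *)
  rewrite (@big_cat_nat _ _ _ (asc w).+2) /=; try lia.
  rewrite [X in _ + X]big_nat [X in _ + X]big1 => [|a /andP[aa _]]; last first.
    by rewrite num_ext_bad // rule; apply/negP => /andP[+ _]; lia.
  rewrite addn0.
  have gh a : maxw w < a -> a <= asc w + 1 ->
      good (rcons w a) = (count_mem 0 w < 3) && (cmax w < 3).
    move=> ma aa; rewrite rule aa (ltnW ma) orbT /=.
    apply/allP/andP => [H|[c3 m3] x xw].
      have H' x : x < a -> count_mem x w < 3.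
        move=> xa; case: (boolP (x \in w)) => [/H|/c0 ->//].
        by rewrite xa.
      split; first by apply: H'; lia.
      (* If only zeros occur, [cmax w] is 0 and the bound is trivial; the other conjunct controls
         the zeros. *)
      by rewrite /cmax; case: eqP => // _; apply: H'.
    apply/implyP=> xa; case: (posnP x) => [->//|x0].
    case: (ltnP x (maxw w)) => [xm|mle]; first by apply: cnt; rewrite x0.
    have xE : x = maxw w by apply/eqP; rewrite eqn_leq mle leq_maxw.
    by move: m3; rewrite /cmax -xE eqn0Ngt x0.
  have rng : (asc w).+2 = (asc w - maxw w).+1 + (maxw w).+1 by lia.
  rewrite -[X in \sum_(X <= _ < _) _]add0n rng big_addn addnK big_mkord.
  case: ifP => G; last first.
    rewrite big1 // => j _; rewrite num_ext_bad // gh ?G //; have := ltn_ord j; lia.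
  apply: eq_bigr => j _; have jl := ltn_ord j.
  set a := j + _; have aw1 : maxw w < a by rewrite /a; lia.
  have aa : a <= asc w + 1 by rewrite /a; lia.
  have na : a \notin w by apply/negP => /leq_maxw; lia.
  rewrite IH ?gh ?G // last_rcons asc_rcons // /cmax maxw_rcons (maxn_idPr (ltnW aw1)).
  rewrite -cats1 !count_cat /= (c0 _ na) eqxx.
  have -> : (a == 0) = false by lia.
  rewrite !addn0 add0n.
  have -> : last 0 w < a by case: lst => ->; lia.
  by congr (extensions _ _ _ _ _); rewrite /a; lia.
rewrite (@big_cat_nat _ _ _ (maxw w).+1) //=; last lia.
by rewrite mcase hi; case: (_ < 3).
Qed.

Lemma b_0001 n : b_ [:: 0; 0; 0; 1] n.+1 = extensions n 1 true 0 0.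
Proof.
have -> : b_ [:: 0; 0; 0; 1] n.+1 = num_ext n.+1 n.+1 [::].
  by rewrite /b_ /B_ cardsE -sum1_card big_mkcond.
(* [good_rcons] requires a nonempty prefix, so the one-letter word is checked directly. *)
have good0 : good [:: 0].
  rewrite /good /is_ascent_seq /= /avoids.
  rewrite (contains021_rcons [::] 0) // (contains0001_rcons [::] 0).
  have nc s x : contains [::] (rcons s x) = false.
    apply/negbTE/negP => /containsP[t]; rewrite subseq0 => /eqP -> [] /eqP.
    by rewrite size_rcons.
  rewrite (nc [:: 0; 2] 1) (nc [:: 0; 0; 0] 1) /= andbT.
  by apply/forallP; case=> -[].
rewrite num_extS big_ord_recl big1 ?addn0 => [|i _]; last first.
  by rewrite num_ext_bad // /good /is_ascent_seq.
rewrite num_ext_extensions //=.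
by rewrite asc_sum /cmax /maxw big_seq1 /= big_geq.
Qed.

(** * Saturated states and the linear system *)

(** After three zeros only zeros may follow. *)
Lemma extensions_3zeros n z l d c : 2 < z -> extensions n z l d c = 1.
Proof.
elim: n z l d c => //= n IH z l d c z3.
by rewrite IH ?(leqW z3) // ltnNge z3 addn0.
Qed.

(** A continuation is a run of the maximum followed by zeros, determined by the length of that
    run. *)
Lemma extensions_2zeros_sat n l d c : 2 < c -> extensions n 2 l d c = n.+1.
Proof.
elim: n l d c => //= n IH l d c c3.
rewrite extensions_3zeros // (ltnNge c) c3 (ltn_trans _ c3) //=.
by rewrite IH ?(leqW c3) // addn0.
Qed.

(** Only 0 and the maximum may follow, and only zeros after the second new zero. Without a new zero
    there is one word; otherwise choose the positions of the first two, with [n + 1] standing for a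
    missing second one. *)
Lemma extensions_1zero_sat n l d c :
  2 < c -> extensions n 1 l d c = 'C(n.+1, 2).+1.
Proof.
elim: n l d c => //= n IH l d c c3.
rewrite extensions_2zeros_sat // (ltnNge c) c3 (ltn_trans _ c3) //= IH ?(leqW c3) //.
by rewrite addn0 [in RHS]binS bin1 addnS addnC.
Qed.

Lemma extensionsS n z l d c : extensions n.+1 z l d c =
    extensions n z.+1 true d c +
    (if z < 3 then
      (if 0 < c then extensions n z false (d + l) c.+1 else 0) +
      (if c < 3 then \sum_(j < d.+1) extensions n z false (d - j) 1 else 0)
     else 0).
Proof. by []. Qed.

(** These ten states are closed under the transitions once saturated states are replaced by their
    closed forms; the product lets one [rewrite] expand them all. *)
Lemma extensions_rec n :
  (extensions n.+1 1 true 0 0 = extensions n 2 true 0 0 + extensions n 1 false 0 1) *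
  (extensions n.+1 1 false 0 1 =
     extensions n 2 true 0 1 + extensions n 1 false 0 2 + extensions n 1 false 0 1) *
  (extensions n.+1 1 false 0 2 =
     extensions n 2 true 0 2 + 'C(n.+1, 2).+1 + extensions n 1 false 0 1) *
  (extensions n.+1 2 true 0 0 = 1 + extensions n 2 false 0 1) *
  (extensions n.+1 2 true 0 1 =
     1 + extensions n 2 false 1 2 + extensions n 2 false 0 1) *
  (extensions n.+1 2 true 0 2 = n.+2 + extensions n 2 false 0 1) *
  (extensions n.+1 2 false 0 1 =
     1 + extensions n 2 false 0 2 + extensions n 2 false 0 1) *
  (extensions n.+1 2 false 0 2 = n.+2 + extensions n 2 false 0 1) *
  (extensions n.+1 2 false 1 1 =
     1 + extensions n 2 false 1 2 + extensions n 2 false 1 1 + extensions n 2 false 0 1) *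
  (extensions n.+1 2 false 1 2 =
     n.+2 + extensions n 2 false 1 1 + extensions n 2 false 0 1).
Proof.
have z3 l d c : extensions n 3 l d c = 1 by apply: extensions_3zeros.
have s2 l d : extensions n 2 l d 3 = n.+1 by apply: extensions_2zeros_sat.
have s1 l d : extensions n 1 l d 3 = 'C(n.+1, 2).+1 by apply: extensions_1zero_sat.
by do ![split]; rewrite extensionsS
  ?big_ord_recl ?big_ord0 /= ?z3 ?s2 ?s1 ?subn0 ?subnn ?addn0 ?add0n; lia.
Qed.

(* Eliminating all the states but the initial one leaves transient terms, so the
   recurrence for [A] needs the initial values when [n < 2]. *)
Lemma linear_rec_elim (A a h d c : nat -> nat) :
  (forall m, A m.+2 = d m + a m.+1 + 1) ->
  (forall m, a m.+3 = a m.+2 + a m.+1 + h m + d m.+1 + 2 * d m + c m + 2 * m + 6) ->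
  (forall m, h m.+2 = h m.+1 + h m + d m.+1 + d m + m.+3) ->
  (forall m, d m.+2 = d m.+1 + d m + m.+3) ->
  (forall m, c m.+1 = c m + m.+2) ->
  [/\ A 0 = 1, A 1 = 2, a 1 = 3 & a 2 = 9] ->
  [/\ h 0 = 1, h 1 = 4, d 0 = 1, d 1 = 3 & c 0 = 1] ->
  [seq A i | i <- iota 0 9] = [:: 1; 2; 5; 13; 33; 77; 170; 358; 729] /\
  forall n, A (n + 9) + 12 * A (n + 7) + 12 * A (n + 4) + 3 * A (n + 3) + A n =
    6 * A (n + 8) + 5 * A (n + 6) + 12 * A (n + 5) + 6 * A (n + 2).
Proof.
move=> AE aE hE dE cE [A0 A1 a1 a2] [h0 h1 d0 d1 c0]; split.
 by rewrite /= !(AE, aE, hE, dE, cE, A0, A1, a1, a2, h0, h1, d0, d1, c0).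
case=> [|[|n]]; rewrite ?addSn ?add0n.
- by rewrite !(AE, aE, hE, dE, cE); lia.
- by rewrite !(AE, aE, hE, dE, cE); lia.
- by rewrite -[n]add0n !addnS !addn0 !(AE, aE, hE, dE, cE); lia.
Qed.

(** Three auxiliary states and a binomial are kept as unknowns, the other states being substituted
    away. Negative coefficients of the denominator are moved across the equation to stay in
    [nat]. *)
Lemma extensions_linear_rec (A := fun k => extensions k 1 true 0 0) :
  [seq A i | i <- iota 0 9] = [:: 1; 2; 5; 13; 33; 77; 170; 358; 729] /\
  forall n, A (n + 9) + 12 * A (n + 7) + 12 * A (n + 4) + 3 * A (n + 3) + A n =
    6 * A (n + 8) + 5 * A (n + 6) + 12 * A (n + 5) + 6 * A (n + 2).
Proof.
have binS2 m : 'C(m.+1, 2) = 'C(m, 2) + m by rewrite binS bin1 addnC.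
have e0 z l d c : extensions 0 z l d c = 1 by [].
apply: (linear_rec_elim A (fun m => extensions m 1 false 0 1)
  (fun m => extensions m 2 false 1 1) (fun m => extensions m 2 false 0 1)
  (fun m => 'C(m.+2, 2))) => [m|m|m|m|m||].
- by rewrite /A !extensions_rec; lia.
- by rewrite !extensions_rec !binS2; lia.
- by rewrite !extensions_rec; lia.
- by rewrite !extensions_rec; lia.
- by rewrite binS2.
- by rewrite /A !extensions_rec !e0.
- by rewrite !extensions_rec !e0.
Qed.

(** * Formal power series arithmetic *)

Local Open Scope ring_scope.

(** A coefficient of a product depends on finitely many terms, so ring laws of polynomials transfer
    to series. *)
Lemma fps_mul_trunc (F : fieldType) (g h : fps F) (n i : nat) : (i < n)%N ->
  fps_mul g h i = ((\poly_(j < n) g j) * (\poly_(j < n) h j))`_i.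
Proof.
move=> lt_in; rewrite coefM; apply: eq_bigr => j _; rewrite !coef_poly.
by rewrite (leq_trans (ltn_ord j)) // (leq_ltn_trans (leq_subr _ _)).
Qed.

Lemma fps_mulA (F : fieldType) (f g h : fps F) :
  fps_mul f (fps_mul g h) =1 fps_mul (fps_mul f g) h.
Proof.
move=> n; pose T (k : fps F) := \poly_(j < n.+1) k j.
transitivity ((T f * T g * T h)`_n); rewrite -?mulrA; last first.
  rewrite mulrA [RHS]/fps_mul coefM; apply: eq_bigr => i _.
  by rewrite (fps_mul_trunc F f g n.+1) // coef_poly ltnS leq_subr.
rewrite [LHS]/fps_mul coefM; apply: eq_bigr => i _.
by rewrite (fps_mul_trunc F g h n.+1) ?ltnS ?leq_subr // coef_poly ltn_ord.
Qed.

Lemma fps_mul_eq_div (F : fieldType) (f g h : fps F) :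
  g 0%N != 0 -> fps_mul f g =1 h -> f =1 fps_div h g.
Proof.
move=> g0 fgh n; transitivity (fps_mul (fps_mul f g) (fps_inv g) n); last first.
  by apply: eq_bigr => i _; rewrite fgh.
rewrite -fps_mulA; transitivity (\sum_(i < n.+1) f i * fps_of_poly 1 (n - i)%N).
  rewrite big_ord_recr big1 /= => [|i _]; rewrite /fps_of_poly coef1.
    by rewrite subnn mulr1 add0r.
  by rewrite subn_eq0 leqNgt ltn_ord mulr0.
by apply: eq_bigr => i _; rewrite fps_mulV.
Qed.

(** Reversing the convolution puts the linear recurrence in view; the size bound keeps [n - i] from
    truncating. *)
Lemma fps_mul_Poly (F : fieldType) (f : fps F) (s : seq F) (n : nat) :
  (size s <= n.+1)%N ->
  fps_mul f (fps_of_poly (Poly s)) n = \sum_(i < size s) s`_i * f (n - i)%N.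
Proof.
move=> le_sn; rewrite /fps_mul (reindex_inj rev_ord_inj) /=.
rewrite (big_ord_widen n.+1 (fun i => s`_i * f (n - i)%N)) // [RHS]big_mkcond /=.
apply: eq_bigr => i _; rewrite subSS subKn ?leq_ord // /fps_of_poly coef_Poly mulrC.
by case: ltnP => // /(nth_default 0) ->; rewrite mul0r.
Qed.

(** * The generating function *)

Lemma denominator_Poly :
  (1 - 'X) ^+ 3 * (1 - 'X - 'X^2) ^+ 3 =
  Poly [:: 1; -6; 12; -5; -12; 12; 3; -6; 0; 1] :> {poly rat}.
Proof.
rewrite /= !cons_poly_def !polyC0 ?polyC1 ?polyCN.
ring.
Qed.

Lemma b_0 tau : tau != [::] -> b_ tau 0 = 1%N.
Proof.
move=> tau_n0; rewrite /b_ (_ : B_ tau 0 = setT) ?cardsT ?card_tuple //.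
apply/setP => t; rewrite !inE tuple0 /word /=.
have nc s : s != [::] -> avoids [::] s.
  move=> sn; apply/negP => /containsP[u]; rewrite subseq0 => /eqP -> [].
  by case: s sn.
rewrite !nc // /is_ascent_seq /= andbT.
by apply/forallP; case.
Qed.

Theorem theorem3p2 :
  f_ [:: 0; 0; 0; 1]%N =1
  fps_div
    (fps_of_poly
       (1 - 5%:R *: 'X + 8%:R *: 'X^2 - 10%:R *: 'X^4 + 5%:R *: 'X^5
          + 'X^6 + 'X^8))
    (fps_of_poly ((1 - 'X) ^+ 3 * (1 - 'X - 'X^2) ^+ 3)).
Proof.
rewrite denominator_Poly.
apply: fps_mul_eq_div; first by rewrite /fps_of_poly coef_Poly.
have -> : 1 - 5%:R *: 'X + 8%:R *: 'X^2 - 10%:R *: 'X^4 + 5%:R *: 'X^5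
    + 'X^6 + 'X^8 = Poly [:: 1; -5; 8; 0; -10; 5; 1; 0; 1] :> {poly rat}.
  rewrite /= !cons_poly_def !polyC0 ?polyC1 ?polyCN -!mul_polyC; ring.
have [vals rec] := extensions_linear_rec.
(* The recurrence concerns [b_ _ k.+1], so it yields the coefficients from degree 10 on, where the
   numerator vanishes. Degree 9 still involves the empty word and is checked numerically with the
   lower degrees. *)
move=> n; case: (ltnP n 10) => [lt_n|/subnK <-]; last first.
  set m := (n - 10)%N; rewrite fps_mul_Poly; last by rewrite /=; lia.
  rewrite [RHS]/fps_of_poly coef_Poly nth_default; last by rewrite /=; lia.
  have E k : (k <= 9)%N ->
      f_ [:: 0; 0; 0; 1]%N (m + 10 - k)%N = (extensions (m + (9 - k)) 1 true 0 0)%:R.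
    by move=> k9; rewrite /f_ -b_0001; congr (b_ _ _)%:R; lia.
  rewrite !big_ord_recl big_ord0 /= !E //.
  have /(congr1 (fun k => k%:R : rat)) := rec m.
  rewrite !natrD !subSS !subn0 !addn0; lra.
(* The extra leading 1 counts the empty word; the remaining nine entries are the initial values in
   [vals]. *)
have fE k : (k < 10)%N -> f_ [:: 0; 0; 0; 1]%N k =
    (nth 0 [:: 1; 1; 2; 5; 13; 33; 77; 170; 358; 729] k)%N%:R.
  case: k => [|k] lt_k; first by rewrite /f_ b_0.
  by rewrite /f_ b_0001 /= -vals (nth_map 0%N) ?size_iota ?nth_iota.
rewrite /fps_mul /fps_of_poly.
under eq_bigr => i _ do rewrite coef_Poly fE ?(leq_ltn_trans (leq_ord i)) //.
rewrite coef_Poly.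
by do 10?[case: n lt_n => [|n] lt_n] => //; rewrite !big_ord_recl big_ord0 /=; lra.
Qed.
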